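(* Every precompact, weak $G$-complete fuzzy metric space is Lebesgue.
   Context: A continuous $t$-norm is a binary operation $*$ on $[0,1]$ that is associative, commutative, continuous on $[0,1]\times[0,1]$, satisfies $a*1=a$ for all $a\in[0,1]$, and satisfies $a*c\le b*d$ whenever $a\le b$ and $c\le d$. A fuzzy metric space (George–Veeramani) is a triple $(X,M,* )$ where $X$ is a non-empty set, $*$ is a continuous $t$-norm and $M:X\times X\times(0,\infty)\to[0,1]$ satisfies, for all $x,y,z\in X$ and $s,t>0$: (a) $M(x,y,t)>0$; (b) $M(x,y,t)=1$ if and only if $x=y$; (c) $M(x,y,t)=M(y,x,t)$; (d) $M(x,y,t)*M(y,z,s)\le M(x,z,t+s)$; (e) $M(x,y,\cdot):(0,\infty)\to[0,1]$ is continuous. For $x\in X$, $r\in(0,1)$, $t>0$ put $B_M(x,r,t)=\{y\in X: M(x,y,t)>1-r\}$; these sets form a base of a topology $\tau_M$ on $X$. Convergence and cluster points of sequences are taken in $(X,\tau_M)$. A fuzzy metric space $(X,M,* )$ is precompact if for all $r\in(0,1)$ and $t>0$ there is a finite subset $A$ of $X$ with $X=\bigcup_{x\in A}B_M(x,r,t)$. A fuzzy metric space $(X,M,* )$ is Lebesgue if for every open cover $\mathcal G$ of $(X,\tau_M)$ there exist $r\in(0,1)$ and $t>0$ such that $\{B_M(x,r,t):x\in X\}$ refines $\mathcal G$, i.e. each $B_M(x,r,t)$ is contained in some member of $\mathcal G$. A sequence $(x_n)$ in $(X,M,* )$ is $G$-Cauchy if $\lim_{n\to\infty}M(x_n,x_{n+p},t)=1$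 for each $t>0$ and $p\in\mathbb N$ (equivalently, $\lim_{n\to\infty}M(x_n,x_{n+1},t)=1$ for all $t>0$). A fuzzy metric space is weak $G$-complete if every $G$-Cauchy sequence in it has a cluster point in it. *)

(* Defs.v *)
From HB Require Import structures.
From mathcomp Require Import all_boot all_order all_algebra.
From mathcomp Require Import all_classical all_reals all_analysis.
From mathcomp Require Import lra.
Set Implicit Arguments.
Unset Strict Implicit.
Unset Printing Implicit Defensive.
Import Order.TTheory GRing.Theory Num.Theory.
Import numFieldNormedType.Exports.
Local Open Scope classical_set_scope.
Local Open Scope ring_scope.

(* A binary operation on [0, 1] is represented by a total function
   [R -> R -> R] of which only the values on [0, 1] x [0, 1] matter. *)
Record is_continuous_tnorm (R : realType) (op : R -> R -> R) : Prop := {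
  tnorm_itv : forall a b : R,
    a \in `[0, 1] -> b \in `[0, 1] -> op a b \in `[0, 1] ;
  tnormA : forall a b c : R, a \in `[0, 1] -> b \in `[0, 1] -> c \in `[0, 1] ->
    op a (op b c) = op (op a b) c ;
  tnormC : forall a b : R, a \in `[0, 1] -> b \in `[0, 1] -> op a b = op b a ;
  tnorm_continuous :
    {within [set` `[0, 1]] `*` [set` `[0, 1]],
      continuous (fun ab : R * R => op ab.1 ab.2)} ;
  tnorm1 : forall a : R, a \in `[0, 1] -> op a 1 = a ;
  tnorm_le : forall a b c d : R,
    a \in `[0, 1] -> b \in `[0, 1] -> c \in `[0, 1] -> d \in `[0, 1] ->
    a <= b -> c <= d -> op a c <= op b d }.

(* Fuzzy metric spaces in the sense of George and Veeramani; the values of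
   [fdist x y t] for [t <= 0] are irrelevant. *)
Record fuzzyMetricSpace (R : realType) := FuzzyMetricSpace {
  fcarrier :> Type ;
  ftnorm : R -> R -> R ;
  fdist : fcarrier -> fcarrier -> R -> R ;
  fcarrier_nonempty : inhabited fcarrier ;
  ftnormP : is_continuous_tnorm ftnorm ;
  fdist_itv : forall x y t, 0 < t -> fdist x y t \in `[0, 1] ;
  fdist_gt0 : forall x y t, 0 < t -> 0 < fdist x y t ;
  fdist_eq1 : forall x y t, 0 < t -> (fdist x y t = 1 <-> x = y) ;
  fdist_sym : forall x y t, 0 < t -> fdist x y t = fdist y x t ;
  fdist_triangle : forall x y z s t, 0 < s -> 0 < t ->
    ftnorm (fdist x y t) (fdist y z s) <= fdist x z (t + s) ;
  fdist_continuous : forall x y,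
    {within [set` `]0, +oo[], continuous (fdist x y)} }.

Definition fball (R : realType) (X : fuzzyMetricSpace R) (x : X) (r t : R)
  : set X := [set y | 1 - r < fdist x y t].

Definition fballs (R : realType) (X : fuzzyMetricSpace R) : set (set X) :=
  [set B | exists (x : X) (r t : R),
    [/\ r \in `]0, 1[, 0 < t & B = fball x r t]].

Section ball_base.
Context (R : realType) (X : fuzzyMetricSpace R).
Implicit Types (x y z : X) (r t : R).

Lemma fballs_cover : \bigcup_(B in @fballs R X) B = setT.
Proof.
rewrite -subTset => x _; exists (fball x (1 / 2) 1).
  by exists x, (1 / 2), 1; split => //; rewrite in_itv/=; lra.
have /(fdist_eq1 x x) [_ e] : 0 < 1 :> R by [].
by rewrite /fball/= e //; lra.
Qed.

Lemma tnorm_near1 (a c : R) : a \in `[0, 1] -> c < a ->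
  exists2 s, s \in `]0, 1[ & c < ftnorm X a s.
Proof.
move=> a01 ca; have T := ftnormP X.
have a1 : ([set` `[0, 1]] `*` [set` `[0, 1]]) (a, 1 : R).
  by split => //=; rewrite in_itv/=; lra.
have ca' : nbhs (ftnorm X a 1) [set y | c < y].
  by rewrite (tnorm1 T a01); exact: lt_nbhsr.
have /subspace_continuousP/(_ (a, 1) a1 _ ca') := tnorm_continuous T.
move=> -[[P Q]/= [Pa Q1] PQ].
move: Q1 => /nbhs_ballP[e /= e0 eQ].
exists (Num.max (1 / 2) (1 - e / 2)).
  by rewrite in_itv/= lt_max gt_max; lra.
apply: (PQ (a, Num.max (1 / 2) (1 - e / 2))) => /=.
  split => /=; first exact: nbhs_singleton.
  apply: eQ; rewrite /ball/= ger0_norm ?subr_ge0 ?ge_max; last lra.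
  by rewrite ltrBlDr -ltrBlDl lt_max; apply/orP; right; lra.
by split => //=; rewrite in_itv/= le_max ge_max; lra.
Qed.

Lemma fdist_le x y s t : 0 < s -> s <= t -> fdist x y s <= fdist x y t.
Proof.
move=> s0; rewrite le_eqVlt => /predU1P[-> //|st].
have ts0 : 0 < t - s by lra.
have := fdist_triangle x y y ts0 s0.
have [_ ->//] := fdist_eq1 y y ts0.
by rewrite (tnorm1 (ftnormP X)) ?fdist_itv // addrC subrK.
Qed.

Lemma fball_sub_fball x y r t : r \in `]0, 1[ -> 0 < t -> fball x r t y ->
  exists r' t', [/\ r' \in `]0, 1[, 0 < t' & fball y r' t' `<=` fball x r t].
Proof.
rewrite in_itv/= => r01 t0 xy.
have [u [u0 ut xyu]] : exists u, [/\ 0 < u, u < t & 1 - r < fdist x y u].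
  have t_in : [set` `]0, +oo[] t by rewrite /= in_itv/= andbT.
  have /subspace_continuousP/(_ t t_in _ (lt_nbhsr xy)) :=
    @fdist_continuous _ _ x y.
  move=> /nbhs_ballP[e /= e0 eP].
  exists (Num.max (t / 2) (t - e / 2)); split.
  - by rewrite lt_max; lra.
  - by rewrite gt_max; lra.
  - apply: eP; last by rewrite /= in_itv/= andbT lt_max; lra.
    rewrite /ball/= ger0_norm ?subr_ge0 ?ge_max; last lra.
    by rewrite ltrBlDr -ltrBlDl lt_max; apply/orP; right; lra.
have [s s01 rs] := tnorm_near1 (fdist_itv x y u0) xyu.
move: (s01); rewrite in_itv/= => s01'.
have tu0 : 0 < t - u by lra.
exists (1 - s), (t - u); split => //; first by rewrite in_itv/=; lra.
move=> z /=; rewrite /fball/= => yz; apply: (lt_le_trans rs).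
rewrite -(subrK u t) [_ - u + u]addrC.
apply: le_trans (fdist_triangle x y z tu0 u0).
by apply: (tnorm_le (ftnormP X)); rewrite ?fdist_itv// ?in_itv/=; lra.
Qed.

Lemma fballs_join (A B : set X) y : @fballs R X A -> @fballs R X B ->
  A y -> B y -> exists C, [/\ @fballs R X C, C y & C `<=` A `&` B].
Proof.
move=> [x1 [r1 [t1 [r101 t10 ->]]]] [x2 [r2 [t2 [r201 t20 ->]]]].
move=> /(fball_sub_fball r101 t10)[r [t [r01 t0 sub1]]].
move=> /(fball_sub_fball r201 t20)[r' [t' [r'01 t'0 sub2]]].
move: r01 r'01; rewrite !in_itv/= => r01 r'01.
have m0 : 0 < Num.min t t' by rewrite lt_min t0.
have m01 : Num.min r r' \in `]0, 1[ by rewrite in_itv/= lt_min gt_min; lra.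
exists (fball y (Num.min r r') (Num.min t t')); split.
- by exists y, (Num.min r r'), (Num.min t t').
- have [_ e] := fdist_eq1 y y m0.
  by rewrite /fball/= e //; move: m01; rewrite in_itv/=; lra.
- move=> z; rewrite {1}/fball/= => yz; split; [apply: sub1|apply: sub2].
  + rewrite /fball/=; apply: le_lt_trans (_ : _ <= 1 - Num.min r r') _.
      by rewrite lerD2l lerN2 ge_min lexx.
    by apply: lt_le_trans yz _; rewrite fdist_le // ge_min lexx.
  + rewrite /fball/=; apply: le_lt_trans (_ : _ <= 1 - Num.min r r') _.
      by rewrite lerD2l lerN2 ge_min lexx orbT.
    by apply: lt_le_trans yz _; rewrite fdist_le // ge_min lexx orbT.
Qed.

End ball_base.

HB.instance Definition _ (R : realType) (X : fuzzyMetricSpace R) :=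
  gen_eqMixin (fcarrier X).
HB.instance Definition _ (R : realType) (X : fuzzyMetricSpace R) :=
  gen_choiceMixin (fcarrier X).
(* The topology having the balls as a base, the base being indexed by
   itself. *)
HB.instance Definition _ (R : realType) (X : fuzzyMetricSpace R) :=
  isBaseTopological.Build (fcarrier X)
    (@fballs_cover R X) (@fballs_join R X).

Definition fuzzy_precompact (R : realType) (X : fuzzyMetricSpace R) : Prop :=
  forall r t : R, r \in `]0, 1[ -> 0 < t ->
  exists2 A : set X, finite_set A & [set: X] = \bigcup_(x in A) fball x r t.

Definition fuzzy_Lebesgue (R : realType) (X : fuzzyMetricSpace R) : Prop :=
  forall G : set (set X), (forall U, G U -> open U) ->
  \bigcup_(U in G) U = [set: X] ->
  exists r t : R, [/\ r \in `]0, 1[, 0 < t &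
    forall x : X, exists2 U, G U & fball x r t `<=` U].

Definition G_Cauchy (R : realType) (X : fuzzyMetricSpace R) (u : nat -> X)
  : Prop :=
  forall (t : R) (p : nat), 0 < t ->
  fdist (u n) (u (n + p)%N) t @[n --> \oo] --> (1 : R).

Definition weak_G_complete (R : realType) (X : fuzzyMetricSpace R) : Prop :=
  forall u : nat -> X, G_Cauchy u -> cluster (u @ \oo) !=set0.

(* Main.v *)
(** If no ball size works for an open cover, choose for every [n] a point [x n]
    whose ball of radius and time [1 / (n + 2)] lies in no member of the cover.
    Precompactness gives [x] a subsequence that is Cauchy in the strong sense,
    hence G-Cauchy, so weak G-completeness provides a cluster point. A small
    ball around it lies in a member of the cover and, by the triangle
    inequality, contains one of the chosen balls: a contradiction. *)
Require Import Defs.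
From mathcomp Require Import all_boot all_order all_algebra.
From mathcomp Require Import all_classical all_reals all_analysis.
From mathcomp Require Import lra.
Set Implicit Arguments.
Unset Strict Implicit.
Unset Printing Implicit Defensive.
Import Order.TTheory GRing.Theory Num.Theory.
Local Open Scope classical_set_scope.
Local Open Scope ring_scope.

Section fuzzy_balls.
Context (R : realType) (X : fuzzyMetricSpace R).
Implicit Types (x y z : X) (r s t : R).

Lemma fball_center x r t : 0 < r -> 0 < t -> fball x r t x.
Proof.
move=> r0 t0; have [_ e] := fdist_eq1 x x t0.
by rewrite /fball/= e //; lra.
Qed.

Lemma fball_sym x y r t : 0 < t -> fball x r t y -> fball y r t x.
Proof. by move=> t0; rewrite /fball/= fdist_sym. Qed.

Lemma sub_fball x r s t u : r <= s -> 0 < t -> t <= u ->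
  fball x r t `<=` fball x s u.
Proof.
move=> rs t0 tu y; rewrite /fball/= => xy.
by have := fdist_le x y t0 tu; lra.
Qed.

(** Two uses of [tnorm_near1], starting from [1], give [a] and [b] with [1 - r < ftnorm X a b].
    Since [s] is [1 - Num.max a b], both values of [fdist] dominate [a] and [b], and monotonicity
    with the triangle inequality concludes. *)
Lemma fball_half r : r \in `]0, 1[ -> exists2 s, s \in `]0, 1[ &
  forall x y z t, 0 < t ->
    fball x s t y -> fball y s t z -> fball x r (t + t) z.
Proof.
rewrite in_itv/= => r01; have T := ftnormP X.
have one01 : (1 : R) \in `[0, 1] by rewrite in_itv/=; lra.
have [a a01 ra] : exists2 a, a \in `]0, 1[ & 1 - r < ftnorm X 1 a.
  by apply: tnorm_near1 => //; lra.
have a01' : a \in `[0, 1] by move: a01; rewrite !in_itv/=; lra.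
rewrite (tnormC T) // (tnorm1 T) // in ra.
have [b b01 rab] := tnorm_near1 X a01' ra.
move: a01 b01; rewrite !in_itv/= => a01 b01.
have m01 : 0 < Num.max a b < 1 by rewrite lt_max gt_max; lra.
exists (1 - Num.max a b); first by rewrite in_itv/=; lra.
move=> x y z t t0; rewrite /fball/= opprB addrC subrK => xy yz.
apply: (lt_le_trans rab); apply: le_trans (fdist_triangle x y z t0 t0).
apply: (tnorm_le T); rewrite ?fdist_itv// ?in_itv/=; try lra.
- by apply: le_trans (ltW xy); rewrite le_max lexx.
- by apply: le_trans (ltW yz); rewrite le_max lexx orbT.
Qed.

(** The base ball around [x] inside [U] may have another centre; [fball_sub_fball] recentres it. *)
Lemma open_fball_center (U : set X) x : open U -> U x ->
  exists r t, [/\ r \in `]0, 1[, 0 < t & fball x r t `<=` U].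
Proof.
case=> D Dballs <- [B DB Bx].
have [z [r [t [r01 t0 eB]]]] := Dballs _ DB.
rewrite /= in Bx; rewrite eB in Bx.
have [r' [t' [r'01 t'0 sub]]] := fball_sub_fball r01 t0 Bx.
exists r', t'; split=> // y /sub ?.
by exists B => //=; rewrite eB.
Qed.

Lemma nbhs_fball x r t : r \in `]0, 1[ -> 0 < t -> nbhs x (fball x r t).
Proof.
move=> r01 t0; apply: open_nbhs_nbhs; split.
  exists [set fball x r t]; last by rewrite bigcup_set1.
  by move=> _ ->; exists x, r, t.
by apply: fball_center => //; move: r01; rewrite in_itv/=; lra.
Qed.

(** Otherwise [F] contains the complements of the preimages of finitely many balls covering [X],
    hence their empty intersection. *)
Lemma precompact_ultra (I : Type) (F : set_system I) (x : I -> X) r t :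
  UltraFilter F -> fuzzy_precompact X -> r \in `]0, 1[ -> 0 < t ->
  exists a, F (x @^-1` fball a r t).
Proof.
move=> FU pX r01 t0; have [A /finite_fsetP[D AD] AX] := pX _ _ r01 t0.
apply: contrapT => /forallNP noa.
have : F (\bigcap_(a in A) ~` (x @^-1` fball a r t)).
  rewrite AD; apply: filter_bigI => a _.
  by have [/noa|] := in_ultra_setVsetC (x @^-1` fball a r t) FU.
move=> /filter_ex[i xi]; have : [set: X] (x i) by [].
by rewrite AX => -[a Aa]; exact: xi.
Qed.

End fuzzy_balls.

(** The shift by 2 keeps the radius below 1 even at [n = 0]. *)
Lemma invS2_itv (R : realType) (n : nat) : (n.+2%:R^-1 : R) \in `]0, 1[.
Proof. by rewrite in_itv/= invr_gt0 ltr0n invf_cp1 ?ltr0n// ltr1n. Qed.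

Lemma near_invS2_lt (R : realType) (e : R) : 0 < e ->
  \forall n \near \oo, n.+2%:R^-1 < e.
Proof.
move=> e0; apply: filterS (near_infty_natSinv_lt (PosNum e0)) => n /=.
by apply: le_lt_trans; rewrite lef_pV2 ?posrE// ler_nat.
Qed.

Section Cauchy_subsequence.
Context (R : realType) (X : fuzzyMetricSpace R).

(* An ultrafilter finer than [\oo] contains, for every [j], a set of indices
   sent into a single ball of radius and time [1 / (j + 2)]; [n k] is picked in
   the first [k + 1] of these sets, so no diagonal extraction is required. *)
Lemma precompact_G_Cauchy_subseq (x : nat -> X) : fuzzy_precompact X ->
  exists2 n : nat -> nat, forall k, (k <= n k)%N & G_Cauchy (x \o n).
Proof.
move=> pX; have [F [FU ooF]] := ultraFilterLemma (F := \oo) _.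
have inv0 j : 0 < j.+2%:R^-1 :> R by rewrite invr_gt0 ltr0n.
have /choice[a Fa] j := precompact_ultra x FU pX (invS2_itv R j) (inv0 j).
have /choice[n nP] k : exists n, (k <= n)%N /\
    forall j, (j <= k)%N -> fball (a j) j.+2%:R^-1 j.+2%:R^-1 (x n).
  have Fk : F [set n | forall j : 'I_k.+1,
      fball (a j) j.+2%:R^-1 j.+2%:R^-1 (x n)].
    by apply: filter_forall => j; exact: Fa.
  have Fge : F [set n | (k <= n)%N] by apply: ooF; exact: nbhs_infty_ge.
  have [n [kn nk]] := filter_ex (filterI Fge Fk).
  by exists n; split=> // j jk; exact: (nk (Ordinal (jk : (j < k.+1)%N))).
exists n => [k|t p t0]; first by have [] := nP k.
apply/cvgrPdist_lt => e e0.
(* [e] may exceed 1, so it is capped to be a legal radius. *)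
have e01 : Num.min e (1 / 2) \in `]0, 1[.
  by rewrite in_itv/= lt_min gt_min; lra.
have [s] := fball_half X e01.
rewrite in_itv/= => /andP[s0 s1] half.
have t20 : 0 < t / 2 by lra.
(* From index [j] on, all terms lie in one ball around [a j], so any two are compared through that
   centre. *)
have [j [js jt]] := filter_ex (filterI (near_invS2_lt s0) (near_invS2_lt t20)).
exists j => // k /= jk.
have inball m : (j <= m)%N -> fball (a j) s (t / 2) (x (n m)).
  move=> jm; have [_ /(_ _ jm)] := nP m.
  by apply: sub_fball => //; exact: ltW.
have := half _ _ _ _ t20 (fball_sym t20 (inball _ jk))
  (inball _ (leq_trans jk (leq_addr p k))).
rewrite -splitr /fball/= => lt1.
have := fdist_itv (x (n k)) (x (n (k + p)%N)) t0.
rewrite in_itv/= => /andP[_ le1].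
rewrite ger0_norm ?subr_ge0//.
have : Num.min e (1 / 2) <= e by rewrite ge_min lexx.
by lra.
Qed.

End Cauchy_subsequence.

Theorem theorem4p2 (R : realType) (X : fuzzyMetricSpace R) :
  fuzzy_precompact X -> weak_G_complete X -> fuzzy_Lebesgue X.
Proof.
move=> pX cX G Gopen Gcover; apply: contrapT => noball.
have inv0 j : 0 < j.+2%:R^-1 :> R by rewrite invr_gt0 ltr0n.
have /choice[x xP] n : exists x : X, forall U, G U ->
    ~ fball x n.+2%:R^-1 n.+2%:R^-1 `<=` U.
  apply: contrapT => /forallNP nox; apply: noball.
  exists n.+2%:R^-1, n.+2%:R^-1; split=> [||x] //; first exact: invS2_itv.
  by have /existsNP[U /not_implyP[GU /contrapT]] := nox x; exists U.
have [n le_n /cX[y ycl]] := precompact_G_Cauchy_subseq x pX.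
have [U GU Uy] : (\bigcup_(U in G) U) y by rewrite Gcover.
have [r [t [r01 t0 sub]]] := open_fball_center (Gopen _ GU) Uy.
have [s s01 half] := fball_half X r01.
have s0 : 0 < s by move: s01; rewrite in_itv/= => /andP[].
have t20 : 0 < t / 2 by lra.
have [N _ NP] := filterI (near_invS2_lt s0) (near_invS2_lt t20).
have tail : ((x \o n) @ \oo) ((x \o n) @` [set k | (N <= k)%N]).
  by exists N => // k Nk; exists k.
(* As [N <= k <= n k], the ball chosen at [x (n k)] has radius below [s] and time below [t / 2];
   halving puts it inside [fball y r t]. *)
have [_ [[k Nk <-] yk]] := ycl _ _ tail (nbhs_fball y s01 t20).
have [ns nt] := NP (n k) (leq_trans Nk (le_n k)).
apply: (xP (n k) U GU) => z xz; apply: sub; rewrite [t]splitr.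
apply: half yk _ => //.
by apply: sub_fball xz => //; exact: ltW.
Qed.
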